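(* Let $G=(V,E,\omega)$ be a finite undirected connected weighted graph, let $\emptyset\neq U\subseteq V$, let $m\geq 1$ and let $g\colon U\to\mathbb{R}^m$. Then there exists a unique tight extension $u\colon V\to\mathbb{R}^m$ of $g$ (i.e. a unique tight function $u$ with $u|_U=g$). Further, $u$ is tighter than every other extension $v\colon V\to\mathbb{R}^m$ of $g$ (i.e. every $v\neq u$ with $v|_U=g$).
   Context: $G=(V,E,\omega)$ is a finite undirected connected weighted graph with symmetric weights $\omega(x,y)\in[0,1]$, where $\omega(x,y)=0$ if and only if $(x,y)\notin E$; write $x\sim y$ iff $(x,y)\in E$. $|\cdot|$ is the Euclidean norm. For $u\colon V\to\mathbb{R}^m$ and $x\in V$ the local Lipschitz constant is $Su(x)=\max_{y\sim x}\sqrt{\omega(x,y)}\,|u(y)-u(x)|$. For $u,v\colon V\to\mathbb{R}^m$ with $u|_U=v|_U$, $u$ is called tighter than $v$ if $$\max\{Sv(x): x\in V\setminus U,\ Su(x)<Sv(x)\}>\max\{Su(x): x\in V\setminus U,\ Sv(x)<Su(x)\},$$ where the maximum over the empty set is $0$. A function $u$ is called tight if there is no $v\colon V\to\mathbb{R}^m$ with $v|_U=u|_U$ that is tighter than $u$. *)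

(* Defs.v *)
From mathcomp Require Import all_boot all_order all_algebra.
From mathcomp Require Import reals.

Set Implicit Arguments.
Unset Strict Implicit.
Unset Printing Implicit Defensive.

Import Order.TTheory GRing.Theory Num.Theory.
Local Open Scope ring_scope.

(* Loops are not excluded: they contribute 0 to the local Lipschitz constant. *)
Record weighted_graph (R : realType) := WeightedGraph {
  vertex :> finType;
  edge : rel vertex;
  weight : vertex -> vertex -> R;
  edge_sym : symmetric edge;
  weight_sym : forall x y, weight x y = weight y x;
  weight_itv : forall x y, 0 <= weight x y <= 1;
  weight_eq0 : forall x y, weight x y = 0 <-> ~~ edge x y
}.

Definition connected_graph (R : realType) (G : weighted_graph R) : Prop :=
  forall x y : G, connect (@edge R G) x y.

(* Euclidean norm; the library norm on matrices is the sup norm. *)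
Definition enorm (R : realType) (m : nat) (a : 'rV[R]_m) : R :=
  Num.sqrt (\sum_(i < m) a 0 i ^+ 2).

(* All maxima below are of nonnegative quantities, so taking 0 as the neutral
   element only matters over the empty range, where the value is then 0. *)
Definition local_lip (R : realType) (G : weighted_graph R) (m : nat)
    (u : G -> 'rV[R]_m) (x : G) : R :=
  \big[Num.max/0]_(y : G | edge x y)
    (Num.sqrt (weight x y) * enorm (u y - u x)).

Definition tighter (R : realType) (G : weighted_graph R) (U : {set G})
    (m : nat) (u v : G -> 'rV[R]_m) : Prop :=
  {in U, u =1 v} /\
  \big[Num.max/0]_(x in ~: U | local_lip u x < local_lip v x) local_lip v x
  > \big[Num.max/0]_(x in ~: U | local_lip v x < local_lip u x) local_lip u x.

Definition tight (R : realType) (G : weighted_graph R) (U : {set G})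
    (m : nat) (u : G -> 'rV[R]_m) : Prop :=
  ~ exists v : G -> 'rV[R]_m, {in U, v =1 u} /\ tighter U v u.

Definition extends (R : realType) (G : weighted_graph R) (U : {set G})
    (m : nat) (g : {x : G | x \in U} -> 'rV[R]_m) (u : G -> 'rV[R]_m) : Prop :=
  forall x : {x : G | x \in U}, u (val x) = g x.

(* Main.v *)
Require Import Defs.
From mathcomp Require Import all_classical all_reals all_analysis.
From mathcomp Require Import all_boot all_order all_algebra.
From mathcomp Require Import reals.
From mathcomp Require Import ring lra.
Import Order.TTheory GRing.Theory Num.Theory.
Import numFieldNormedType.Exports.

Set Implicit Arguments.
Unset Strict Implicit.
Unset Printing Implicit Defensive.

Local Open Scope ring_scope.

(** Write Su for [local_lip u].  Everything rests on the convexity of S: along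
    the segment from u to z, every slope of an edge is at most the
    corresponding convex combination.  Hence a tight u admits no direction z
    that weakly lowers all edges realizing Su at the vertices at or above some level
    and strictly lowers those at one vertex of that level, since a small step
    towards z would give a tighter function ([tight_no_descent]).

    Comparing a tight u with an extension v, look at the highest level t at
    which Su and Sv differ.  If Sv < Su = t somewhere, then v itself is such a
    direction; so only Su < Sv = t can occur at that level, and u is tighter
    than v, unless Su = Sv off U altogether ([tight_tighter_or_eq]).

    In that last case the midpoint w of u and v satisfies Sw <= Su, hence
    Sw = Su and w is tight.  By strict convexity of the Euclidean norm, v - u is
    constant along every edge realizing Sw at a vertex off U.  A level set A of
    v - u for a nonzero value therefore contains all edges that realize Sw at
    its vertices, and its boundary edges realize Sw at no end off U; shrinking
    the values on A towards a point is then a descent direction unless Sw = 0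
    on A.  But then A is closed under adjacency, so it is the whole graph,
    whereas v = u on the nonempty set U ([tight_eq_lip]).

    It remains to find one tight extension.  Truncating coordinates does not
    increase S, so one may work in a compact box.  There, minimize
    lexicographically the sums of the k largest values of S over the vertices
    off U, for k = 0, 1, 2 and so on ([compact_lex_min]).  A tighter function
    would be lexicographically smaller ([tighter_top_lip]), so the minimizer is
    tight.  It is the only tight extension, since any other one is beaten by it. *)

(** * The Euclidean norm *)

Lemma enorm_ge0 (R : realType) (m : nat) (a : 'rV[R]_m) : 0 <= enorm a.
Proof. exact: sqrtr_ge0. Qed.

Lemma enorm_sqr (R : realType) (m : nat) (a : 'rV[R]_m) :
  enorm a ^+ 2 = \sum_(i < m) a 0 i ^+ 2.
Proof. by rewrite sqr_sqrtr// sumr_ge0// => i _; exact: sqr_ge0. Qed.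

Lemma enorm0 (R : realType) (m : nat) : enorm (0 : 'rV[R]_m) = 0.
Proof.
by rewrite /enorm big1 ?sqrtr0// => i _; rewrite mxE expr0n.
Qed.

Lemma enorm_eq0 (R : realType) (m : nat) (a : 'rV[R]_m) :
  enorm a <= 0 -> a = 0.
Proof.
move=> a0; have : enorm a ^+ 2 = 0.
  by apply/eqP; rewrite sqrf_eq0 eq_le a0 enorm_ge0.
rewrite enorm_sqr => /eqP; rewrite psumr_eq0; last by move=> i _; exact: sqr_ge0.
move=> /allP a00; apply/rowP => i; rewrite mxE; apply/eqP.
by rewrite -sqrf_eq0; exact: a00 (mem_index_enum i).
Qed.

Lemma enormZ (R : realType) (m : nat) (k : R) (a : 'rV[R]_m) :
  enorm (k *: a) = `|k| * enorm a.
Proof.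
rewrite -sqrtr_sqr /enorm -sqrtrM ?sqr_ge0// mulr_sumr; congr Num.sqrt.
by apply: eq_bigr => i _; rewrite mxE exprMn.
Qed.

(** Cauchy-Schwarz, from expanding the square of |b| a - |a| b. *)
Lemma dot_le_enorm (R : realType) (m : nat) (a b : 'rV[R]_m) :
  \sum_(i < m) a 0 i * b 0 i <= enorm a * enorm b.
Proof.
have [a0|a0] := leP (enorm a) 0.
  rewrite (enorm_eq0 a0) enorm0 mul0r big1// => i _.
  by rewrite mxE mul0r.
have [b0|b0] := leP (enorm b) 0.
  rewrite (enorm_eq0 b0) enorm0 mulr0 big1// => i _.
  by rewrite mxE mulr0.
set al := enorm a in a0 *; set be := enorm b in b0 *.
have : 0 <= \sum_(i < m) (be * a 0 i - al * b 0 i) ^+ 2.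
  by apply: sumr_ge0 => i _; exact: sqr_ge0.
have -> : \sum_(i < m) (be * a 0 i - al * b 0 i) ^+ 2 =
   be ^+ 2 * \sum_(i < m) a 0 i ^+ 2 + al ^+ 2 * \sum_(i < m) b 0 i ^+ 2
   - 2 * (al * be) * \sum_(i < m) a 0 i * b 0 i.
  rewrite !mulr_sumr -big_split -sumrB /=; apply: eq_bigr => i _; ring.
rewrite -!enorm_sqr -/al -/be => h.
have ab0 : 0 < al * be by exact: mulr_gt0.
by rewrite -(ler_pM2l ab0); lra.
Qed.

Lemma enormD (R : realType) (m : nat) (a b : 'rV[R]_m) :
  enorm (a + b) <= enorm a + enorm b.
Proof.
rewrite -ler_sqr ?nnegrE ?addr_ge0 ?enorm_ge0//.
have -> : enorm (a + b) ^+ 2 =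
    enorm a ^+ 2 + enorm b ^+ 2 + 2 * \sum_(i < m) a 0 i * b 0 i.
  rewrite !enorm_sqr mulr_sumr -!big_split /=.
  by apply: eq_bigr => i _; rewrite mxE; ring.
have := dot_le_enorm a b; lra.
Qed.

(** Strict convexity of the norm, from the parallelogram identity: two vectors
    that are no longer than their midpoint are equal. *)
Lemma enorm_midpoint_inj (R : realType) (m : nat) (a b c : 'rV[R]_m) :
  c = 2^-1 *: (a + b) -> enorm a <= enorm c -> enorm b <= enorm c -> a = b.
Proof.
move=> cE ac bc; apply/eqP; rewrite -subr_eq0; apply/eqP/enorm_eq0.
have par : enorm (a - b) ^+ 2 =
    2 * enorm a ^+ 2 + 2 * enorm b ^+ 2 - 4 * enorm c ^+ 2.
  rewrite cE !enorm_sqr !mulr_sumr -!big_split -sumrB /=.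
  by apply: eq_bigr => i _; rewrite !mxE; field.
have {}ac : enorm a ^+ 2 <= enorm c ^+ 2 by rewrite ler_sqr ?nnegrE ?enorm_ge0.
have {}bc : enorm b ^+ 2 <= enorm c ^+ 2 by rewrite ler_sqr ?nnegrE ?enorm_ge0.
rewrite -ler_sqr ?nnegrE ?enorm_ge0//; lra.
Qed.

(** * Slopes of edges and local Lipschitz constants *)

Definition slope (R : realType) (G : weighted_graph R) (m : nat)
    (u : G -> 'rV[R]_m) (x y : G) : R :=
  Num.sqrt (weight x y) * enorm (u y - u x).

Definition mix (R : realType) (G : weighted_graph R) (m : nat) (s : R)
    (u v : G -> 'rV[R]_m) (x : G) : 'rV[R]_m :=
  (1 - s) *: u x + s *: v x.

Lemma sqrt_weight_gt0 (R : realType) (G : weighted_graph R) (x y : G) :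
  edge x y -> 0 < Num.sqrt (weight x y).
Proof.
move=> xy; rewrite sqrtr_gt0 lt0r.
have /andP[-> _] := weight_itv x y; rewrite andbT.
by apply/negP => /eqP /weight_eq0; rewrite xy.
Qed.

Lemma slope_ge0 (R : realType) (G : weighted_graph R) (m : nat)
    (u : G -> 'rV[R]_m) (x y : G) : 0 <= slope u x y.
Proof. by rewrite mulr_ge0 ?sqrtr_ge0 ?enorm_ge0. Qed.

Lemma slope_mix (R : realType) (G : weighted_graph R) (m : nat) (s : R)
    (u v : G -> 'rV[R]_m) (x y : G) : 0 <= s <= 1 ->
  slope (mix s u v) x y <= (1 - s) * slope u x y + s * slope v x y.
Proof.
move=> /andP[s0 s1]; rewrite /slope /mix.
have -> : (1 - s) *: u y + s *: v y - ((1 - s) *: u x + s *: v x) =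
    (1 - s) *: (u y - u x) + s *: (v y - v x).
  by rewrite !scalerBr opprD addrACA.
rewrite mulrCA (mulrCA s) -mulrDr ler_wpM2l ?sqrtr_ge0//.
rewrite (le_trans (enormD _ _))// !enormZ.
by rewrite (ger0_norm s0) ger0_norm// subr_ge0.
Qed.

Lemma slope_le_lip (R : realType) (G : weighted_graph R) (m : nat)
    (u : G -> 'rV[R]_m) (x y : G) : edge x y -> slope u x y <= local_lip u x.
Proof. by move=> xy; exact: (le_bigmax_cond _ (slope u x)). Qed.

Lemma local_lip_ge0 (R : realType) (G : weighted_graph R) (m : nat)
    (u : G -> 'rV[R]_m) (x : G) : 0 <= local_lip u x.
Proof. exact: bigmax_ge_id. Qed.

Lemma local_lip_le (R : realType) (G : weighted_graph R) (m : nat)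
    (u : G -> 'rV[R]_m) (x : G) (c : R) : 0 <= c ->
  (forall y, edge x y -> slope u x y <= c) -> local_lip u x <= c.
Proof. exact: bigmax_le. Qed.

Lemma local_lip_lt (R : realType) (G : weighted_graph R) (m : nat)
    (u : G -> 'rV[R]_m) (x : G) (c : R) : 0 < c ->
  (forall y, edge x y -> slope u x y < c) -> local_lip u x < c.
Proof. exact: bigmax_lt. Qed.

(** The inequality between the two maxima is witnessed by one vertex: a point
    where v attains its maximum dominates every vertex at which u is worse. *)
Lemma tighterP (R : realType) (G : weighted_graph R) (U : {set G}) (m : nat)
    (u v : G -> 'rV[R]_m) :
  tighter U u v <->
  {in U, u =1 v} /\
  exists x, [/\ x \notin U, local_lip u x < local_lip v x &
    forall y, y \notin U -> local_lip v y < local_lip u y ->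
      local_lip u y < local_lip v x].
Proof.
split=> -[uv H]; split=> //.
- have [/existsP[x /and3P[xU xlt xmax]]|] := boolP [exists x,
    [&& x \notin U, local_lip u x < local_lip v x &
     \big[Num.max/0]_(y in ~: U | local_lip v y < local_lip u y) local_lip u y
     < local_lip v x]].
    exists x; split=> // y yU ylt.
    apply: le_lt_trans xmax; apply: (le_bigmax_cond _ (local_lip u)).
    by rewrite inE yU.
  move=> /existsPn none; exfalso; move: H; apply/negP; rewrite -leNgt.
  apply: bigmax_le => [|x /andP[]]; first exact: bigmax_ge_id.
  rewrite inE => xU xlt; rewrite leNgt; apply/negP => h.
  by have := none x; rewrite xU xlt h.
- move: H => [x [xU xlt H]].
  apply: (@lt_le_trans _ _ (local_lip v x)); last first.
    by apply: (le_bigmax_cond _ (local_lip v)); rewrite inE xU.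
  apply: bigmax_lt => [|y /andP[]].
    exact: le_lt_trans (local_lip_ge0 _ _) xlt.
  by rewrite inE; exact: H.
Qed.

(** * Tight functions against other extensions *)

(** Finitely many strict inequalities survive a small enough common step. *)
Lemma exists_small_step (R : realType) (I : finType) (a b c : I -> R) :
  exists2 s, 0 < s <= 1 &
    forall i, a i < c i -> (1 - s) * a i + s * b i < c i.
Proof.
pose q := \sum_(i | a i < c i) `|b i - a i| / (c i - a i).
have qpos i : a i < c i -> 0 <= `|b i - a i| / (c i - a i).
  by move=> aci; rewrite divr_ge0// subr_ge0 ltW.
have q0 : 0 <= q by apply: sumr_ge0.
have q1 : 0 < 1 + q by rewrite ltr_pwDl.
exists (1 + q)^-1.
  by rewrite invr_gt0 q1 invf_le1// lerDl.
move=> i aci; have ca : 0 < c i - a i by rewrite subr_gt0.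
have qi : `|b i - a i| / (c i - a i) <= q.
  by rewrite /q (bigD1 i)//= lerDl sumr_ge0// => j /andP[/qpos].
rewrite ler_pdivrMr// in qi.
have : (1 + q)^-1 * (b i - a i) < c i - a i.
  rewrite mulrC ltr_pdivrMr//; have := ler_norm (b i - a i); lra.
lra.
Qed.

(** A small step s from u towards z keeps the strict inequalities: slopes that
    do not realize Su stay below it, and vertices with Su below the level of x0
    stay below that level.  The realizing slopes are controlled by z.  So the
    step improves x0 and can only worsen vertices that remain below its level,
    which makes it tighter than u. *)
Lemma tight_no_descent (R : realType) (G : weighted_graph R) (U : {set G})
    (m : nat) (u z : G -> 'rV[R]_m) (x0 : G) :
  tight U u -> {in U, z =1 u} -> x0 \notin U -> 0 < local_lip u x0 ->
  (forall x y, x \notin U -> local_lip u x0 <= local_lip u x -> edge x y ->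
     slope u x y = local_lip u x -> slope z x y <= local_lip u x) ->
  ~ (forall y, edge x0 y -> slope u x0 y = local_lip u x0 ->
     slope z x0 y < local_lip u x0).
Proof.
set t := local_lip u x0 => utight zu x0U t0 Hle Hlt.
(* The third family is the ceiling that an edge must stay strictly below: the
   level t at low vertices, the old local Lipschitz constant at high ones. *)
have [s /andP[s0 s1] Hs] := @exists_small_step R (G * G)%type
  (fun p => slope u p.1 p.2) (fun p => slope z p.1 p.2)
  (fun p => if local_lip u p.1 < t then t else local_lip u p.1).
have s01 : 0 <= s <= 1 by rewrite s1 ltW.
pose w := mix s u z.
have wt x : local_lip u x < t -> local_lip w x < t.
  move=> xt; apply: local_lip_lt => // y xy.
  apply: le_lt_trans (slope_mix _ _ _ _ s01) _.
  have := Hs (x, y); rewrite /= xt; apply.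
  exact: le_lt_trans (slope_le_lip _ xy) xt.
have step x y : t <= local_lip u x -> edge x y ->
    slope u x y < local_lip u x -> slope w x y < local_lip u x.
  move=> tx xy ux; apply: le_lt_trans (slope_mix _ _ _ _ s01) _.
  by have := Hs (x, y); rewrite /= (ltNge _ t) tx; exact.
have wle x : x \notin U -> t <= local_lip u x -> local_lip w x <= local_lip u x.
  move=> xU tx; apply: local_lip_le => [|y xy]; first exact: local_lip_ge0.
  have := slope_le_lip u xy; rewrite le_eqVlt => /predU1P[uE|]; last first.
    by move=> /(step _ _ tx xy)/ltW.
  apply: le_trans (slope_mix _ _ _ _ s01) _.
  have := Hle x y xU tx xy uE; rewrite -(ler_pM2l s0) uE; lra.
have wlt : local_lip w x0 < t.
  apply: local_lip_lt => // y xy.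
  have := slope_le_lip u xy; rewrite le_eqVlt => /predU1P[uE|]; last first.
    exact: step.
  apply: le_lt_trans (slope_mix _ _ _ _ s01) _.
  have := Hlt y xy uE; rewrite -(ltr_pM2l s0) uE -/t; lra.
apply: utight; exists w.
have wu : {in U, w =1 u}.
  by move=> x xU; rewrite /w /mix zu// -scalerDl subrK scale1r.
split=> //; apply/tighterP; split=> //; exists x0; split=> // y yU uwy.
apply: wt; rewrite ltNge; apply/negP => /(wle _ yU).
by rewrite leNgt uwy.
Qed.

(** At the highest level where Su and Sv differ, no vertex can have Sv < Su:
    otherwise v would be a descent direction for u.  All differences at that
    level are thus in favour of u. *)
Lemma tight_tighter_or_eq (R : realType) (G : weighted_graph R) (U : {set G})
    (m : nat) (u v : G -> 'rV[R]_m) :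
  tight U u -> {in U, v =1 u} ->
  tighter U u v \/ {in ~: U, local_lip u =1 local_lip v}.
Proof.
move=> utight vu.
pose D : pred G := fun x => (x \notin U) && (local_lip u x != local_lip v x).
pose M x := Num.max (local_lip u x) (local_lip v x).
have [x1 Dx1|D0] := pickP D; last first.
  right=> x; rewrite inE => xU.
  by have := D0 x; rewrite /D xU => /negbFE/eqP.
(* M x2 is the highest level at which the two constants differ. *)
have [x2 /andP[x2U x2neq] maxM] := arg_maxP M Dx1.
have [/existsP[x0 /and3P[x0U vux0 /eqP x0M]]|none] := boolP [exists x0,
    [&& x0 \notin U, local_lip v x0 < local_lip u x0 & local_lip u x0 == M x2]].
  exfalso; apply: (@tight_no_descent _ _ U _ u v x0) => //.
  - exact: le_lt_trans (local_lip_ge0 _ _) vux0.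
  - move=> x y xU x0x xy _; apply: le_trans (slope_le_lip _ xy) _.
    rewrite leNgt; apply/negP => uvx.
    have : M x <= M x2 by apply: maxM; rewrite /D xU lt_eqF.
    by rewrite -x0M /M ge_max => /andP[_]; rewrite leNgt (le_lt_trans x0x uvx).
  - by move=> y xy _; exact: le_lt_trans (slope_le_lip _ xy) vux0.
move/existsPn: none => none.
have uvx2 : local_lip u x2 < local_lip v x2.
  have := none x2; rewrite x2U /M /=; case: ltgtP x2neq => //= vux _.
  by rewrite eqxx.
have Mx2 : M x2 = local_lip v x2 by rewrite /M max_r// ltW.
left; apply/tighterP; split=> [x xU|]; first by rewrite vu.
exists x2; split=> // y yU vuy.
have := none y; rewrite yU vuy /= -Mx2 => yM; rewrite lt_neqAle yM /=.
apply: (@le_trans _ _ (M y)); first by rewrite /M le_max lexx.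
by apply: maxM; rewrite /D yU gt_eqF.
Qed.

Lemma eq_tight (R : realType) (G : weighted_graph R) (U : {set G})
    (m : nat) (u w : G -> 'rV[R]_m) :
  {in U, w =1 u} -> {in ~: U, local_lip w =1 local_lip u} ->
  tight U u -> tight U w.
Proof.
move=> wu lipE utight [z [zw /tighterP[_ [x [xU zx Hx]]]]].
have lE y : y \notin U -> local_lip w y = local_lip u y.
  by move=> yU; apply: lipE; rewrite inE.
have zu : {in U, z =1 u} by move=> y yU; rewrite zw// wu.
apply: utight; exists z; split=> //; apply/tighterP; split=> //.
exists x; split; rewrite -?lE// => y yU; rewrite -lE//; exact: Hx.
Qed.

(** A tight function is determined off U by its local Lipschitz constants.  The
    argument runs on the midpoint w, which is again tight and forces v - u to
    be constant along the edges realizing Sw.  If v - u took a nonzero value,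
    its level set could be contracted to a point without touching any realizing
    edge outside it. *)
Lemma tight_eq_lip (R : realType) (G : weighted_graph R) (U : {set G})
    (m : nat) (u v : G -> 'rV[R]_m) :
  connected_graph G -> U != set0 -> tight U u -> {in U, v =1 u} ->
  {in ~: U, local_lip u =1 local_lip v} -> v =1 u.
Proof.
move=> Gconn U0 utight vu lipE.
have half01 : 0 <= (2^-1 : R) <= 1 by apply/andP; split; lra.
pose w := mix 2^-1 u v.
have wu : {in U, w =1 u}.
  by move=> x xU; rewrite /w /mix vu// -scalerDl subrK scale1r.
have wle x : x \notin U -> local_lip w x <= local_lip u x.
  move=> xU; apply: local_lip_le => [|y xy]; first exact: local_lip_ge0.
  have h := lipE x; rewrite inE xU in h.
  have := slope_mix u v x y half01; have := slope_le_lip u xy.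
  by have := slope_le_lip v xy; rewrite -h// /w; lra.
have lipw : {in ~: U, local_lip w =1 local_lip u}.
  have [/tighterP[_ [x [xU uw _]]]|] := tight_tighter_or_eq utight wu.
    by have := wle x xU; rewrite leNgt uw.
  by move=> uw x xU; rewrite uw.
have wtight := eq_tight wu lipw utight.
have rigid x y : x \notin U -> edge x y -> slope w x y = local_lip w x ->
    v y - u y = v x - u x.
  move=> xU xy wE.
  have xU' : x \in ~: U by rewrite inE.
  have c0 := sqrt_weight_gt0 xy.
  have au : enorm (u y - u x) <= enorm (w y - w x).
    rewrite -(ler_pM2l c0) -/(slope w x y) wE lipw//; exact: slope_le_lip.
  have av : enorm (v y - v x) <= enorm (w y - w x).
    rewrite -(ler_pM2l c0) -/(slope w x y) wE lipw// lipE//; exact: slope_le_lip.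
  have wE' : w y - w x = 2^-1 *: ((u y - u x) + (v y - v x)).
    by apply/rowP => i; rewrite /w /mix !mxE; field.
  have e := enorm_midpoint_inj wE' au av.
  apply/eqP; rewrite -subr_eq0.
  have -> : v y - u y - (v x - u x) = (v y - v x) - (u y - u x).
    by apply/rowP => i; rewrite !mxE; ring.
  by rewrite e subrr.
move=> x1; apply/eqP; rewrite -subr_eq0; apply/negPn/negP => d1.
pose A := [set x | v x - u x == v x1 - u x1].
have AU x : x \in A -> x \notin U.
  rewrite inE => /eqP dx; apply/negP => /vu vux.
  by move: d1; rewrite -dx vux subrr eqxx.
have rigidA x y : x \notin U -> edge x y -> slope w x y = local_lip w x ->
    (y \in A) = (x \in A).
  by move=> xU xy wE; rewrite !inE (rigid x y).
(* The contraction of A: any common value on A would serve. *)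
pose z x := if x \in A then 0 else w x.
have zw : {in U, z =1 w}.
  by move=> x xU; rewrite /z; case: ifP => // /AU; rewrite xU.
have zA x y : x \in A -> y \in A -> slope z x y = 0.
  by move=> xA yA; rewrite /slope /z xA yA subrr enorm0 mulr0.
have flat x : x \in A -> local_lip w x = 0.
  move=> xA; apply/eqP; rewrite eq_le local_lip_ge0 andbT leNgt; apply/negP => wx.
  apply: (@tight_no_descent _ _ U _ w z x wtight zw (AU x xA) wx).
    move=> a b aU _ ab abE; have := rigidA a b aU ab abE.
    have [aA bA|aA bA] := boolP (a \in A).
      by rewrite zA// local_lip_ge0.
    by rewrite -abE /slope /z bA (negbTE aA).
  move=> y xy /(rigidA x y (AU x xA) xy); rewrite xA => yA; by rewrite zA.
(* Where Sw vanishes every edge realizes it, so A absorbs all neighbours. *)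
have closedA : closed (@edge R G) A.
  apply: intro_closed; first exact/sym_connect_sym/edge_sym.
  move=> x y xy xA; rewrite (rigidA x y) ?AU//.
  apply/eqP; rewrite eq_le slope_le_lip//= flat//; exact: slope_ge0.
have /set0Pn[x2 x2U] := U0.
have := closed_connect closedA (Gconn x1 x2).
by rewrite inE eqxx => /esym/AU; rewrite x2U.
Qed.

(** * Existence of a tight extension *)

(** Restrict successively to the minimizers of F 0, F 1, and so on.  Each set is
    a sublevel set inside the previous one, hence still compact. *)
Lemma compact_lex_min (R : realType) (T : topologicalType) (n : nat)
    (K : set T) (F : nat -> T -> R) :
  (K !=set0)%classic -> compact K -> (forall k, continuous (F k)) ->
  exists2 u, K u & forall v, K v -> forall k, (k < n)%N ->
    (forall j, (j < k)%N -> F j v <= F j u) -> F k u <= F k v.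
Proof.
elim: n K F => [|n IHn] K F K0 Kc Fc.
  by have [u Ku] := K0; exists u.
have [c cK cmin] := compact_EVT_min K0 Kc (continuous_subspaceT (Fc 0%N)).
pose K' := (K `&` [set u | F 0%N u <= F 0%N c])%classic.
have [||u [Ku u0] umin] := IHn K' (fun k => F k.+1) _ _ (fun k => Fc k.+1).
- by exists c; split; [exact: set_mem|exact: lexx].
- apply: compact_closedI => //.
  have -> : [set u | F 0%N u <= F 0%N c]%classic =
      (F 0%N @^-1` [set x | x <= F 0%N c])%classic by [].
  by apply: closed_comp => [x _|]; [exact: Fc|exact: closed_le].
exists u => // v Kv [_ _|k kn le_vu].
  by apply: le_trans u0 _; apply: cmin; exact: mem_set.
apply: umin => //; first by split => //; apply: le_trans u0; exact: le_vu.
by move=> j jk; exact: le_vu.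
Qed.

(** The sum of the k largest local Lipschitz constants at vertices off U, where k
    is at most the number of such vertices (and 0 for larger k).  Unlike a sorted
    list of the values, this form is visibly continuous in u. *)
Definition top_lip (R : realType) (G : weighted_graph R) (U : {set G})
    (m : nat) (u : G -> 'rV[R]_m) (k : nat) : R :=
  \big[Num.max/0]_(A : {set G} | (A \subset ~: U) && (#|A| == k))
    \sum_(x in A) local_lip u x.

Lemma exists_superset_card (T : finType) (A L : {set T}) (k : nat) :
  A \subset L -> (#|A| <= k <= #|L|)%N ->
  exists B : {set T}, [/\ A \subset B, B \subset L & #|B| = k].
Proof.
move=> AL /andP[Ak kL].
have kA : (k - #|A| <= #|L :\: A|)%N.
  by rewrite cardsD (setIidPr AL) leq_sub2r.
have [s [s_uniq s_size sLA]] := card_geqP kA.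
exists (A :|: [set x in s]); split.
- exact: subsetUl.
- rewrite subUset AL; apply/subsetP => x; rewrite inE => /sLA.
  by rewrite inE => /andP[].
- have dis : A :&: [set x in s] = set0.
    apply/setP => x; rewrite !inE; apply/negP => /andP[xA /sLA].
    by rewrite inE xA.
  by rewrite cardsU dis cards0 subn0 cardsE (card_uniqP s_uniq) s_size subnKC.
Qed.

(** Let t be the local Lipschitz constant of u at the decisive vertex x0, and L the
    set of vertices where Su >= t.  Since v is nowhere worse than u at a height of
    t or more, v satisfies Sv <= Su wherever Sv >= t, and all such vertices
    lie in L, which also contains x0.  For j <= |L|, any j values of Sv are therefore
    dominated by j values of Su on L; for j = |L| one of the values of Sv falls
    below t, and the comparison is strict. *)
Lemma tighter_top_lip (R : realType) (G : weighted_graph R) (U : {set G})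
    (m : nat) (u v : G -> 'rV[R]_m) :
  tighter U v u ->
  exists k, [/\ (k <= #|G|)%N, top_lip U v k < top_lip U u k &
    forall j, (j < k)%N -> top_lip U v j <= top_lip U u j].
Proof.
move=> /tighterP[_ [x0 [x0U vux0 Hx0]]].
set t := local_lip u x0 in vux0 Hx0.
have t0 : 0 < t by exact: le_lt_trans (local_lip_ge0 _ _) vux0.
pose L := [set x | (x \notin U) && (t <= local_lip u x)].
have LU : L \subset ~: U by apply/subsetP => x; rewrite !inE => /andP[].
have x0L : x0 \in L by rewrite inE x0U lexx.
(* H collects the values of at least t in A; the others are below t and are
   compared with arbitrary further elements of L. *)
have dom (A : {set G}) : A \subset ~: U -> (#|A| <= #|L|)%N ->
    exists B : {set G}, [/\ B \subset ~: U, #|B| = #|A|,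
      \sum_(x in A) local_lip v x <= \sum_(x in B) local_lip u x &
      #|A| = #|L| -> \sum_(x in A) local_lip v x < \sum_(x in B) local_lip u x].
  move=> AU AL; pose H := A :&: [set x | t <= local_lip v x].
  have HA : H \subset A by exact: subsetIl.
  have HP x : x \in H -> [/\ x \notin U, t <= local_lip v x &
      local_lip v x <= local_lip u x].
    rewrite !inE => /andP[/(subsetP AU)]; rewrite inE => xU tv; split=> //.
    by rewrite leNgt; apply/negP => /(Hx0 _ xU); rewrite ltNge tv.
  have HL : H \subset L.
    apply/subsetP => x /HP[xU tv vu]; rewrite inE xU; exact: le_trans vu.
  have [|B [HB BL cardB]] := @exists_superset_card _ H L #|A| HL.
    by rewrite AL subset_leq_card.
  have cardBA : #|B :\: H| = #|A :\: H|.
    by rewrite !cardsD (setIidPr HB) (setIidPr HA) cardB.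
  have sumH (f : G -> R) (C : {set G}) : H \subset C ->
      \sum_(x in C) f x = \sum_(x in H) f x + \sum_(x in C :\: H) f x.
    by move=> HC; rewrite (big_setID H) /= (setIidPr HC).
  have le1 : \sum_(x in H) local_lip v x <= \sum_(x in H) local_lip u x.
    by apply: ler_sum => x /HP[].
  have lt2 x : x \in A :\: H -> local_lip v x < t.
    by rewrite inE => /andP[xH xA]; move: xH; rewrite !inE xA -ltNge.
  have le3 : t *+ #|B :\: H| <= \sum_(x in B :\: H) local_lip u x.
    rewrite -sumr_const; apply: ler_sum => x; rewrite inE => /andP[_].
    by move=> /(subsetP BL); rewrite inE => /andP[].
  rewrite cardBA -sumr_const in le3.
  exists B; split=> //; first exact: subset_trans BL LU.
    rewrite (sumH _ A)// (sumH _ B)// lerD// (le_trans _ le3)//.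
    by apply: ler_sum => x /lt2/ltW.
  move=> cardA; rewrite (sumH _ A)// (sumH _ B)// ler_ltD// (lt_le_trans _ le3)//.
  apply: ltr_sum => //.
  have /subsetPn[x xA xH] : ~~ (A \subset H).
    apply/negP => AH.
    have /eqP HLE : H == L.
      by rewrite eqEcard HL -cardA subset_leq_card.
    by move: x0L; rewrite -HLE => /HP[_]; rewrite leNgt vux0.
  by apply/hasP; exists x; rewrite ?mem_index_enum// inE xH xA.
exists #|L|; split; first exact: max_card.
- have le_top (B : {set G}) : B \subset ~: U -> #|B| = #|L| ->
      \sum_(x in B) local_lip u x <= top_lip U u #|L|.
    move=> BU /eqP cB.
    by apply: (le_bigmax_cond _ (fun B : {set G} => \sum_(x in B) local_lip u x));
      rewrite BU.
  apply: bigmax_lt.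
    apply: lt_le_trans (le_top L LU erefl).
    rewrite (bigD1 x0)//= ltr_pwDl// sumr_ge0// => x _; exact: local_lip_ge0.
  move=> A /andP[AU /eqP cA].
  have [|B [BU cB _ /(_ cA) lt_AB]] := dom A AU; first by rewrite cA.
  by apply: lt_le_trans lt_AB _; apply: le_top; rewrite ?cB.
- move=> j jL; apply: bigmax_le => [|A /andP[AU /eqP cA]].
    exact: bigmax_ge_id.
  have [|B [BU cB le_AB _]] := dom A AU; first by rewrite cA ltnW.
  apply: le_trans le_AB _.
  apply: (le_bigmax_cond _ (fun B : {set G} => \sum_(x in B) local_lip u x)).
  by rewrite BU cB cA eqxx.
Qed.

(** A function on the vertices given by all its real coordinates at once, so that
    boxes are products of segments. *)
Definition of_coords (R : realType) (G : weighted_graph R) (m : nat)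
    (f : {ptws (G * 'I_m)%type -> R}) (x : G) : 'rV[R]_m :=
  \row_i f (x, i).

Lemma continuous_local_lip (R : realType) (G : weighted_graph R) (m : nat)
    (x : G) :
  continuous (fun f : {ptws (G * 'I_m)%type -> R} => local_lip (of_coords f) x).
Proof.
have projB y i : continuous
    (fun f : {ptws (G * 'I_m)%type -> R} => f (y, i) - f (x, i)).
  move=> f; apply: (@continuousB R R^o {ptws (G * 'I_m)%type -> R}
    (fun f => f (y, i)) (fun f => f (x, i))).
    exact: (@proj_continuous _ (fun=> R) (y, i)).
  exact: (@proj_continuous _ (fun=> R) (x, i)).
have sqB y i : continuous (fun f : {ptws (G * 'I_m)%type -> R} =>
    (of_coords f y - of_coords f x) 0 i ^+ 2).
  have -> : (fun f : {ptws (G * 'I_m)%type -> R} =>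
      (of_coords f y - of_coords f x) 0 i ^+ 2) =
    (fun f => (f (y, i) - f (x, i)) ^+ 2).
    by apply/funext => h; rewrite !mxE.
  move=> f; apply: (@continuous_comp _ _ _
    (fun f : {ptws (G * 'I_m)%type -> R} => f (y, i) - f (x, i))
    (fun a : R => a ^+ 2)); first exact: projB.
  exact: exprn_continuous.
have sumB y : continuous (fun f : {ptws (G * 'I_m)%type -> R} =>
    \sum_(i < m) (of_coords f y - of_coords f x) 0 i ^+ 2).
  by apply: (@continuous_big R) => [|i _]; [exact: add_continuous|exact: sqB].
apply: (@continuous_big R); first exact: max_continuous.
move=> y _ f; apply: (@continuous_comp _ _ _
    (fun f : {ptws (G * 'I_m)%type -> R} => enorm (of_coords f y - of_coords f x))
    (fun a : R => Num.sqrt (weight x y) * a)); last exact: mulrl_continuous.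
apply: (@continuous_comp _ _ _ _ (@Num.sqrt R)); first exact: sumB.
exact: sqrt_continuous.
Qed.

Lemma continuous_top_lip (R : realType) (G : weighted_graph R) (U : {set G})
    (m k : nat) :
  continuous (fun f : {ptws (G * 'I_m)%type -> R} => top_lip U (of_coords f) k).
Proof.
apply: continuous_big => [|A _]; first exact: max_continuous.
apply: continuous_big => [|x _]; first exact: add_continuous.
exact: continuous_local_lip.
Qed.

Definition clamp (R : realType) (c a : R) : R := Num.max (- c) (Num.min c a).

Lemma clamp_itv (R : realType) (c a : R) : 0 <= c -> - c <= clamp c a <= c.
Proof.
move=> c0; rewrite /clamp le_max lexx /= ge_max ge_min lexx andbT; lra.
Qed.

Lemma clamp_id (R : realType) (c a : R) : `|a| <= c -> clamp c a = a.
Proof.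
by rewrite ler_norml => /andP[ca ac]; rewrite /clamp min_r// max_r.
Qed.

Lemma clamp_sqr_lip (R : realType) (c a b : R) :
  (clamp c a - clamp c b) ^+ 2 <= (a - b) ^+ 2.
Proof.
rewrite -ler_sqrt ?sqr_ge0// !sqrtr_sqr /clamp.
have [h1 h2] : a - b <= `|a - b| /\ b - a <= `|a - b|.
  by split; [exact: ler_norm|rewrite distrC; exact: ler_norm].
have minL : `|Num.min c a - Num.min c b| <= `|a - b|.
  rewrite ler_norml; apply/andP.
  by case: (leP c a) => ?; case: (leP c b) => ?; split; lra.
apply: le_trans minL; set p := Num.min c a; set q := Num.min c b.
have [h3 h4] : p - q <= `|p - q| /\ q - p <= `|p - q|.
  by split; [exact: ler_norm|rewrite distrC; exact: ler_norm].
rewrite ler_norml; apply/andP.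
by case: (leP (- c) p) => ?; case: (leP (- c) q) => ?; split; lra.
Qed.

(** The lexicographic minimizer over the box spanned by the size of the boundary
    values is tight: a tighter competitor can be truncated into the box without
    increasing any local Lipschitz constant, and so would beat the minimizer. *)
Lemma tight_extension_exists (R : realType) (G : weighted_graph R)
    (U : {set G}) (m : nat) (u0 : G -> 'rV[R]_m) :
  exists2 u, {in U, u =1 u0} & tight U u.
Proof.
pose c := \big[Num.max/0]_(p : (G * 'I_m)%type) `|u0 p.1 0 p.2|.
have c0 : 0 <= c by exact: bigmax_ge_id.
have u0c x i : `|u0 x 0 i| <= c.
  exact: (le_bigmax _ (fun p : (G * 'I_m)%type => `|u0 p.1 0 p.2|) (x, i)).
pose lo (p : (G * 'I_m)%type) := if p.1 \in U then u0 p.1 0 p.2 else - c.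
pose hi (p : (G * 'I_m)%type) := if p.1 \in U then u0 p.1 0 p.2 else c.
pose K : set {ptws (G * 'I_m)%type -> R} :=
  [set f | forall p, `[lo p, hi p]%classic (f p)]%classic.
have Kc : compact K.
  apply: (@tychonoff _ (fun=> R) (fun p => `[lo p, hi p]%classic)) => p.
  exact: segment_compact.
pose box (v : G -> 'rV[R]_m) : {ptws (G * 'I_m)%type -> R} :=
  fun p => clamp c (v p.1 0 p.2).
have boxU v : {in U, v =1 u0} -> {in U, of_coords (box v) =1 u0}.
  move=> vu0 x xU; apply/rowP => i; rewrite mxE /box /= vu0//.
  exact: clamp_id.
have boxK v : {in U, v =1 u0} -> K (box v).
  move=> vu0 [x i]; rewrite /= in_itv /lo /hi /=; case: ifPn => xU.
    by rewrite /box /= vu0// clamp_id// lexx.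
  exact: clamp_itv.
have box_lip v x : local_lip (of_coords (box v)) x <= local_lip v x.
  apply: local_lip_le => [|y xy]; first exact: local_lip_ge0.
  apply: le_trans (slope_le_lip v xy).
  rewrite ler_wpM2l ?sqrtr_ge0// ler_wsqrtr// ler_sum// => i _.
  rewrite !mxE; exact: clamp_sqr_lip.
have K0 : (K !=set0)%classic by exists (box u0); apply: boxK.
have [f Kf fmin] := @compact_lex_min R _ #|G|.+1 K
  (fun k f => top_lip U (of_coords f) k) K0 Kc (@continuous_top_lip _ _ U m).
have fU : {in U, of_coords f =1 u0}.
  move=> x xU; apply/rowP => i; rewrite mxE.
  have := Kf (x, i); rewrite /= in_itv /lo /hi /= xU => fE.
  by apply/eqP; rewrite eq_le andbC.
exists (of_coords f) => // -[v [vf /tighterP[_ [x [xU vfx Hx]]]]].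
have vu0 : {in U, v =1 u0} by move=> y yU; rewrite vf// fU.
have : tighter U (of_coords (box v)) (of_coords f).
  apply/tighterP; split; first by move=> y yU; rewrite boxU// fU.
  exists x; split=> //; first exact: le_lt_trans (box_lip v x) vfx.
  move=> y yU yb; apply: le_lt_trans (box_lip v y) _; apply: Hx => //.
  exact: lt_le_trans (box_lip v y).
move=> /tighter_top_lip[k [kG lt_k le_j]].
have := fmin _ (boxK v vu0) k; rewrite ltnS => /(_ kG le_j).
by rewrite leNgt lt_k.
Qed.

Theorem theorem5p22 (R : realType) (G : weighted_graph R)
    (hG : connected_graph G) (U : {set G}) (hU : U != set0)
    (m : nat) (hm : (1 <= m)%N) (g : {x : G | x \in U} -> 'rV[R]_m) :
  exists u : G -> 'rV[R]_m,
    unique (fun w : G -> 'rV[R]_m => extends g w /\ tight U w) u /\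
    (forall v : G -> 'rV[R]_m, extends g v -> v <> u -> tighter U u v).
Proof.
pose u0 x : 'rV[R]_m := if insub x is Some y then g y else 0.
have extE v : extends g v <-> {in U, v =1 u0}.
  split=> [gv x xU|vu0 x]; last by rewrite vu0 ?(valP x)// /u0 valK.
  by rewrite /u0 insubT -gv.
have [u uu0 utight] := tight_extension_exists U u0.
have best v : extends g v -> v <> u -> tighter U u v.
  move=> /extE vu0 vNu.
  have vu : {in U, v =1 u} by move=> x xU; rewrite vu0// uu0.
  have [//|lipE] := tight_tighter_or_eq utight vu.
  by case: vNu; apply/funext; exact: (tight_eq_lip hG hU utight vu lipE).
exists u; split=> //; split; first by split=> //; apply/extE.
move=> w [gw wtight]; apply/eqP/negPn/negP => /eqP uw.
have uw' : tighter U u w by apply: best => // wu; exact: uw.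
apply: wtight; exists u; split=> //.
by case: uw'.
Qed.
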